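(* Let $n\geqslant r\geqslant 2$. There exists a constant $c_1'=c_1'(r)$ (depending only on $r$) such that every $r$-graph $H$ on $n$ vertices can be decomposed into (i.e. its edge set is the disjoint union of the edge sets of) balanced complete $r$-partite $r$-graphs $K_{s_i:r}$, $i=1,\dots,m$, with $s_i\leqslant(\log n)^{1/(r-1)}$ for all $i$ and $$\sum_{i=1}^m s_i^{r-1}\leqslant \frac{c_1' n^r}{(\log n)^{1/(r-1)}}.$$
   Context: An $r$-graph is a collection of $r$-element subsets of a vertex set. $K_{s:r}$ denotes the balanced complete $r$-partite $r$-graph: vertex set a disjoint union of $r$ sets of size $s$, edges all $r$-sets meeting each part in exactly one vertex. Logarithms are base 2. *)

(* Defs.v *)
From mathcomp Require Import all_boot all_order all_algebra.
From mathcomp Require Import reals exp.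

Set Implicit Arguments.
Unset Strict Implicit.
Unset Printing Implicit Defensive.

Import Order.TTheory GRing.Theory Num.Theory.

Definition is_rgraph (T : finType) (r : nat) (H : {set {set T}}) : Prop :=
  forall e : {set T}, e \in H -> #|e| = r.

(* F is the edge set of a copy of K_{s:r} whose vertices lie in T. *)
Definition is_balanced_complete (T : finType) (r s : nat)
    (F : {set {set T}}) : Prop :=
  exists P : 'I_r -> {set T},
    [/\ forall i : 'I_r, #|P i| = s,
        forall i j : 'I_r, i != j -> [disjoint P i & P j]
      & F = [set e : {set T} | [&& e \subset \bigcup_(i < r) P i, #|e| == r
                                 & [forall i : 'I_r, #|e :&: P i| == 1%N]]]].

Definition is_edge_decomposition (T : finType) (m : nat) (H : {set {set T}})
    (F : 'I_m -> {set {set T}}) : Prop :=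
  (forall i j : 'I_m, i != j -> [disjoint F i & F j]) /\
  H = \bigcup_(i < m) F i.

Local Open Scope ring_scope.

Definition log2 (R : realType) (x : R) : R := ln x / ln 2.

(* Main.v *)
(* Erdős's theorem on complete r-partite subgraphs, made quantitative: an
   r-graph with e edges on n vertices contains a K_{s:r} with s at least a
   constant times (log n / log (2 n^r / e))^(1/(r-1)), where s is also at most
   (log n)^(1/(r-1)).  It is found by fixing the parts one coordinate at a time,
   keeping as many as possible of the completions that are common to the chosen
   part.  Since the logarithm is dominated by a square root, s is at least a
   constant times (log n)^(1/(r-1)) sqrt(e / n^r).

   Copies are removed greedily.  A copy contributes s^(r-1) to the sum and uses
   s^r edges, so each removed edge costs 1/s, and
   sqrt(n^r / e) / (log n)^(1/(r-1)) summed over e = 1, ..., n^r is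
   O(n^r / (log n)^(1/(r-1))). *)
Require Import Defs.
From mathcomp Require Import all_boot all_order all_algebra.
From mathcomp Require Import reals exp zify ring.

Set Implicit Arguments.
Unset Strict Implicit.
Unset Printing Implicit Defensive.

Import Order.TTheory GRing.Theory Num.Theory.

(** * Binomial coefficients and falling factorials *)

Lemma ffact_le_exp n s : n ^_ s <= n ^ s.
Proof.
elim: s => // s IHs; rewrite ffactnSr expnSr leq_mul //; exact: leq_subr.
Qed.

Lemma exp_le_ffact d s : (d - s) ^ s <= d ^_ s.
Proof.
suff H m : m <= s -> (d - s) ^ m <= d ^_ m by exact: H.
elim: m => // m IHm lt_ms; rewrite ffactnSr expnSr.
by apply: leq_mul; [apply: IHm; exact: ltnW | lia].
Qed.

(** After multiplication by $s!$, the left side is at most $n^s \le q^s (d-s)^s$, and $(d-s)^s$ is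
    at most the falling factorial of [d]. *)
Lemma leq_bin_scale n d q s :
  n <= q * (d - s) -> 'C(n, s) <= q ^ s * 'C(d, s).
Proof.
move=> le_n; rewrite -(leq_pmul2r (fact_gt0 s)) -mulnA !bin_ffact.
apply: leq_trans (ffact_le_exp _ _) _.
have le_exp m : n ^ m <= (q * (d - s)) ^ m.
  by case: m => // m; rewrite leq_exp2r.
by apply: leq_trans (le_exp s) _; rewrite expnMn leq_mul2l exp_le_ffact orbT.
Qed.

(** * Common neighbourhoods in bipartite graphs *)

Definition common_nbhd (V W : finType) (E : {set V * W}) (P : {set V}) :=
  [set w | [forall x in P, (x, w) \in E]].

Lemma sum_card_nbhd (V W : finType) (E : {set V * W}) :
  \sum_w #|[set x | (x, w) \in E]| = #|E|.
Proof.
rewrite -sum1_card (eq_bigr (fun w => \sum_(x | (x, w) \in E) 1)).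
  by rewrite (exchange_big_dep xpredT) //= pair_big_dep /=; apply: eq_bigl => -[].
by move=> w _; rewrite -sum1_card; apply: eq_bigl => x; rewrite inE.
Qed.

(** Both sides count the pairs [(P, w)] with [P] an [s]-set inside the neighbourhood of [w]. *)
Lemma sum_bin_card_nbhd (V W : finType) (E : {set V * W}) s :
  \sum_w 'C(#|[set x | (x, w) \in E]|, s)
    = \sum_(P : {set V} | #|P| == s) #|common_nbhd E P|.
Proof.
rewrite (eq_bigr (fun w => \sum_(P : {set V} | #|P| == s)
          (w \in common_nbhd E P : nat))); last first.
  move=> w _; rewrite -cards_draws -sum1_card big_mkcond [RHS]big_mkcond /=.
  apply: eq_bigr => P _; rewrite !inE andbC; case: eqP => //= _.
  congr (nat_of_bool _); apply/subsetP/forall_inP => H x /H; by rewrite inE.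
rewrite exchange_big /=; apply: eq_bigr => P _.
by rewrite -sum1_card [RHS]big_mkcond; apply: eq_bigr => w _; case: ifP.
Qed.

(** Averaging: at least a $1/(2q)$ share of [W] is heavy, that is, has at least $|V|/(2q)$
    neighbours, and a heavy neighbourhood contains at least a $(4q)^{-s}$ share of all [s]-sets. An
    [s]-set with the most common neighbours does at least as well as the average one. *)
Lemma exists_large_common_nbhd (V W : finType) (E : {set V * W}) (q s : nat) :
  0 < #|V| -> 0 < q -> 4 * q * s <= #|V| -> #|V| * #|W| <= q * #|E| ->
  exists P : {set V}, #|P| = s /\
    #|W| <= 2 * q * (4 * q) ^ s * #|common_nbhd E P|.
Proof.
move=> V0 q0 le_s dens.
set d := fun w => #|[set x | (x, w) \in E]|.
pose heavy := [set w | #|V| <= 2 * q * d w].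
have le_heavy : #|W| <= 2 * q * #|heavy|.
  (* Here $2|V||W| \le \sum_w 2q\,d(w)$, where a light [w] contributes at most $|V|$ and a heavy one
     at most $2q|V|$. *)
  rewrite -(leq_pmul2l V0) -(leq_add2r (#|V| * #|W|)).
  have -> : #|V| * #|W| + #|V| * #|W| = 2 * (#|V| * #|W|) by lia.
  apply: leq_trans (_ : _ <= 2 * (q * #|E|)) _; first by rewrite leq_mul2l dens orbT.
  rewrite -sum_card_nbhd mulnA big_distrr /= -/(d _).
  have -> : #|V| * (2 * q * #|heavy|) = \sum_w (w \in heavy) * (#|V| * (2 * q)).
    rewrite -big_distrl /= mulnA mulnC -sum1_card [in LHS]big_mkcond /=.
    by congr (_ * _); apply: eq_bigr => w _; case: ifP.
  have -> : #|V| * #|W| = \sum_(w : W) #|V| by rewrite sum_nat_const mulnC.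
  rewrite -big_split /=; apply: leq_sum => w _.
  rewrite -/(d w) inE; case: (leqP #|V| (2 * q * d w)) => [_|/ltnW le_d] /=;
    last by rewrite mul0n.
  rewrite mul1n; apply: leq_trans (leq_addr _ _).
  by rewrite mulnC leq_mul2r max_card orbT.
have [P0 /eqP cP0] : exists P : {set V}, #|P| == s.
  have : 0 < 'C(#|V|, s) by rewrite bin_gt0; nia.
  by rewrite -card_draws card_gt0 => /set0Pn[P]; rewrite inE; exists P.
pose c (P : {set V}) := #|common_nbhd E P|.
have [P /eqP cP maxP] := arg_maxnP c (introT eqP cP0 : (fun P : {set V} => #|P| == s) P0).
exists P; split=> //.
have C0 : 0 < 'C(#|V|, s) by rewrite bin_gt0; nia.
rewrite -(leq_pmul2l C0) -/(c P).
apply: leq_trans (_ : _ <= 2 * q * (4 * q) ^ s * \sum_w 'C(d w, s)) _.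
  apply: leq_trans (_ : _ <= 'C(#|V|, s) * (2 * q * #|heavy|)) _.
    by rewrite leq_mul2l le_heavy orbT.
  rewrite mulnCA -[2 * q * _ * _]mulnA leq_mul2l; apply/orP; right.
  rewrite mulnC -sum_nat_const big_distrr /= [X in X <= _]big_mkcond /=.
  apply: leq_sum => w _; case: ifP => //; rewrite inE => hw.
  (* Heaviness gives $4q\,d(w) \ge 2|V|$, and $4qs \le |V|$, so $4q(d(w)-s) \ge |V|$. *)
  apply: leq_bin_scale; rewrite mulnBr.
  have -> : 4 * q * d w = 2 * (2 * q * d w) by nia.
  by move: hw le_s; move: (2 * q * d w) (4 * q * s) #|V| => a b v; lia.
rewrite sum_bin_card_nbhd mulnCA leq_mul2l; apply/orP; right.
rewrite -card_draws -sum_nat_const; under [leqRHS]eq_bigl do rewrite inE.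
by apply: leq_sum => A cA; exact: maxP.
Qed.

(** * Boxes in dense sets of tuples *)

(* With density 1/q, one step replaces 4q by at most (4q)^(s+2); the invariant
   is stated for four times the inverse density so that the steps compose. *)
Lemma exists_boxes (V : finType) (s k : nat) (W : finType)
    (E : {set k.-tuple V * W}) (q : nat) :
  0 < #|V| -> 0 < s -> 0 < q -> (4 * q) ^ ((s + 2) ^ k) * s <= #|V| ->
  #|V| ^ k * #|W| <= q * #|E| ->
  exists (Ps : seq {set V}) (W' : {set W}),
    [/\ size Ps = k, all (fun P : {set V} => #|P| == s) Ps,
        4 * #|W| <= (4 * q) ^ ((s + 2) ^ k) * #|W'|
      & forall (t : k.-tuple V) w, all2 (fun x (P : {set V}) => x \in P) t Ps ->
          w \in W' -> (t, w) \in E].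
Proof.
move=> V0 s0; elim: k W E q => [|k IHk] W E q q0.
  rewrite !expn0 mul1n expn1 => le_n dens.
  exists [::], [set w | ([tuple], w) \in E]; split=> //; last first.
    by move=> t w _; rewrite inE (tuple0 t).
  rewrite -mulnA leq_mul2l /=; apply: leq_trans dens _; rewrite leq_mul2l.
  apply/orP; right; apply: leq_trans (leq_imset_card (pair [tuple]) _).
  apply: subset_leq_card; apply/subsetP => -[t w]; rewrite (tuple0 t) => tw.
  by apply/imsetP; exists w; rewrite ?inE.
rewrite expnS => le_n dens.
(* Splitting off the head coordinate turns [E] into a bipartite graph between [V] and the pairs of a
   tail and a point of [W], of the same density. *)
pose f (p : V * (k.-tuple V * W)) := ([tuple of p.1 :: p.2.1], p.2.2).
have f_bij : bijective f.
  exists (fun p => (thead p.1, ([tuple of behead p.1], p.2))).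
    case=> x [t w]; rewrite /f /= theadE; congr (_, (_, _)); exact: val_inj.
  by case=> t w; rewrite /f /=; congr (_, _); rewrite [RHS]tuple_eta.
have exp_gt0 : 0 < (s + 2) ^ k by rewrite expn_gt0 addnS.
have [] := @exists_large_common_nbhd _ _ (f @^-1: E) q s V0 q0.
- apply: leq_trans le_n; rewrite leq_mul2r -[X in X <= _]expn1.
  by rewrite leq_pexp2l ?orbT; nia.
- rewrite on_card_preimset ?card_prod ?card_tuple; first by rewrite mulnA -expnS.
  exact: onW_bij.
move=> P [cP]; rewrite card_prod card_tuple => dens1.
have le_q : 4 * (2 * q * (4 * q) ^ s) <= (4 * q) ^ (s + 2).
  by rewrite expnD; nia.
have le_exp : (4 * (2 * q * (4 * q) ^ s)) ^ ((s + 2) ^ k)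
    <= (4 * q) ^ ((s + 2) * (s + 2) ^ k).
  by rewrite expnM leq_exp2r.
have [||Ps [W' [sPs allPs cW' PsE]]] := IHk W _ _ _ _ dens1.
- by rewrite !muln_gt0 expn_gt0 q0 muln_gt0 q0.
- by apply: leq_trans le_n; rewrite leq_mul2r le_exp orbT.
exists (P :: Ps), W'; split=> /=.
- by rewrite sPs.
- by rewrite cP eqxx.
- by apply: leq_trans cW' _; rewrite leq_mul2r le_exp orbT.
move=> t w; rewrite [in X in X -> _](tuple_eta t) /= => /andP[xP tPs] wW'.
have := PsE [tuple of behead t] w tPs wW'.
by rewrite inE => /forall_inP/(_ _ xP); rewrite inE /f /= -tuple_eta.
Qed.

(** The head coordinate plays the role of [W] in [exists_boxes]; the size hypothesis then forces
    $|W'| \ge s$, so the remaining part can be chosen inside [W']. *)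
Lemma exists_complete_boxes (V : finType) (s k q : nat)
    (E : {set k.+1.-tuple V}) :
  0 < #|V| -> 0 < s -> 0 < q -> (4 * q) ^ ((s + 2) ^ k) * s <= #|V| ->
  #|V| ^ k.+1 <= q * #|E| ->
  exists P : 'I_k.+1 -> {set V}, (forall i, #|P i| = s) /\
    forall t : k.+1.-tuple V, (forall i, tnth t i \in P i) -> t \in E.
Proof.
move=> V0 s0 q0 le_n dens.
pose f (p : k.-tuple V * V) := [tuple of p.2 :: p.1].
have f_bij : bijective f.
  exists (fun t : k.+1.-tuple V => ([tuple of behead t] : k.-tuple V, thead t)).
    case=> t w; rewrite /f /= theadE; congr (_, _); exact: val_inj.
  by move=> t; rewrite /f /= [RHS]tuple_eta.
have [|Ps [W' [sPs /allP allPs cW' PsE]]] :=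
  @exists_boxes V s k V (f @^-1: E) q V0 s0 q0 le_n.
  rewrite on_card_preimset; last exact: onW_bij.
  by rewrite -expnSr.
have W's : s <= #|W'|.
  have exp0 : 0 < (4 * q) ^ ((s + 2) ^ k) by rewrite expn_gt0 muln_gt0 q0.
  rewrite -(leq_pmul2l exp0); apply: leq_trans le_n _.
  by apply: leq_trans cW'; rewrite leq_pmull.
have [P0 P0W' cP0] : exists2 P : {set V}, P \subset W' & #|P| = s.
  have : 0 < 'C(#|W'|, s) by rewrite bin_gt0.
  rewrite -cards_draws card_gt0 => /set0Pn[P]; rewrite inE => /andP[PW' /eqP cP].
  by exists P.
exists (fun i => nth set0 (P0 :: Ps) i); split.
  move=> i; case: (unliftP ord0 i) => [j|] -> //=.
  by apply/eqP/allPs/mem_nth; rewrite sPs; exact: (ltn_ord j).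
move=> t tP; rewrite [t]tuple_eta.
have := PsE [tuple of behead t] (thead t).
rewrite inE /f /=; apply; last by apply: (subsetP P0W'); exact: (tP ord0).
rewrite all2E size_tuple sPs eqxx /=; apply/(all_nthP (thead t, set0)) => j.
rewrite size_zip size_tuple sPs minnn => lt_jk.
rewrite nth_zip ?size_tuple // nth_behead.
by have := tP (Ordinal (lt_jk : j.+1 < k.+1)); rewrite (tnth_nth (thead t)).
Qed.

(** * From boxes of tuples to complete partite subgraphs *)

Lemma card_le_edge_tuples (V : finType) r (H : {set {set V}}) :
  is_rgraph r H -> #|H| <= #|[set t : r.-tuple V | [set x in t] \in H]|.
Proof.
move=> rH.
apply: leq_trans (leq_imset_card (fun t : r.-tuple V => [set x in t]) _).
apply/subset_leq_card/subsetP => e eH.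
have se : size (enum e) == r by rewrite -cardE rH.
by apply/imsetP; exists (Tuple se); [rewrite inE|]; rewrite ?set_enum //; apply/setP => x;
  rewrite inE mem_enum.
Qed.

Lemma card_rgraph_le (V : finType) r (H : {set {set V}}) :
  is_rgraph r H -> #|H| <= #|V| ^ r.
Proof.
move=> rH; apply: leq_trans (card_le_edge_tuples rH) _.
by rewrite -card_tuple max_card.
Qed.

Definition complete_edges (V : finType) r (P : 'I_r -> {set V}) :=
  [set e : {set V} | [&& e \subset \bigcup_(i < r) P i, #|e| == r
                       & [forall i : 'I_r, #|e :&: P i| == 1]]].

(** Every choice of one vertex per part spans an edge, which has [r] elements, so the chosen
    vertices are distinct. This makes the parts disjoint, and the edges of the copy correspond
    bijectively to the $s^r$ choice functions. *)
Lemma complete_of_boxes (V : finType) r s (H : {set {set V}})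
    (P : 'I_r -> {set V}) :
  is_rgraph r H -> 0 < s -> (forall i, #|P i| = s) ->
  (forall t : r.-tuple V, (forall i, tnth t i \in P i) -> [set x in t] \in H) ->
  exists F : {set {set V}},
    [/\ is_balanced_complete r s F, F \subset H & #|F| = s ^ r].
Proof.
move=> rH s0 cP PH.
have im_tuple (f : 'I_r -> V) : [set x in [tuple f i | i < r]] = f @: 'I_r.
  apply/setP => x; rewrite inE; apply/mapP/imsetP.
    by case=> i _ ->; exists i.
  by case=> i _ ->; exists i; rewrite ?mem_enum.
have {}PH (f : 'I_r -> V) : (forall i, f i \in P i) -> f @: 'I_r \in H.
  by move=> fP; rewrite -im_tuple; apply: PH => i; rewrite tnth_mktuple.
have f_inj (f : 'I_r -> V) : (forall i, f i \in P i) -> injective f.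
  move=> fP i j fij.
  have /imset_injP f_inj : #|f @: 'I_r| == #|'I_r|.
    by rewrite (rH _ (PH f fP)) card_ord.
  exact: f_inj.
have /fin_all_exists[x0 x0P] : forall i, exists v, v \in P i.
  by move=> i; apply/set0Pn; rewrite -card_gt0 cP.
have disjP i j : i != j -> [disjoint P i & P j].
  apply: contraR => /pred0Pn[v /andP[/= vi vj]]; apply/eqP.
  (* A vertex common to two parts could be chosen in both, against injectivity. *)
  pose f k := if k == i then v else if k == j then v else x0 k.
  apply: (f_inj f); last by rewrite /f !eqxx; case: eqP.
  by rewrite /f => k; case: eqP => [->|_] //; case: eqP => [->|_].
have sepP i j v : v \in P i -> v \in P j -> i = j.
  move=> vi vj; apply/eqP/contraT => /disjP/pred0P/(_ v).
  by rewrite /= vi vj.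
have meet1 (f : 'I_r -> V) i : (forall i, f i \in P i) -> f @: 'I_r :&: P i = [set f i].
  move=> fP; apply/setP => x; rewrite !inE; apply/andP/eqP => [[/imsetP[j _ ->] fji]|->].
    by rewrite (sepP _ _ _ fji (fP j)).
  by rewrite imset_f.
have edgeP e : reflect (exists2 f : 'I_r -> V, forall i, f i \in P i & e = f @: 'I_r)
    (e \in complete_edges P).
  rewrite inE; apply: (iffP and3P) => [[_ /eqP ce /forallP e1]|[f fP ->]].
    have /fin_all_exists[f fe] : forall i, exists v, v \in e :&: P i.
      by move=> i; apply/set0Pn; rewrite -card_gt0 (eqP (e1 i)).
    have fP i : f i \in P i by have := fe i; rewrite inE => /andP[].
    exists f => //; apply/esym/eqP.
    rewrite eqEcard ce card_imset ?card_ord ?leqnn ?andbT; last exact: f_inj.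
    by apply/subsetP => _ /imsetP[i _ ->]; have := fe i; rewrite inE => /andP[].
  split.
  + by apply/subsetP => _ /imsetP[i _ ->]; apply/bigcupP; exists i; rewrite ?fP.
  + by rewrite card_imset ?card_ord //; exact: f_inj.
  + by apply/forallP => i; rewrite meet1 ?cards1.
exists (complete_edges P); split.
- by exists P; split.
- by apply/subsetP => e /edgeP[f fP ->]; exact: PH.
have -> : complete_edges P
    = (fun f : {ffun 'I_r -> V} => f @: 'I_r) @: [set f in family (fun i => mem (P i))].
  apply/setP => e; apply/edgeP/imsetP => [[f fP ->]|[f]].
    exists (finfun f); last by apply: eq_imset => i; rewrite ffunE.
    by rewrite inE; apply/familyP => i; rewrite ffunE fP.
  by rewrite inE => /familyP fP ->; exists f.
rewrite card_in_imset.
  rewrite cardsE card_family foldrE big_map big_enum /=.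
  by under eq_bigr do rewrite cP; rewrite prod_nat_const card_ord.
move=> f g; rewrite !inE => /familyP fP /familyP gP eq_fg; apply/ffunP => i.
by apply/set1P; rewrite -meet1 // -eq_fg meet1 // set11.
Qed.

Lemma complete_of_edge (V : finType) r (H : {set {set V}}) :
  is_rgraph r H -> H != set0 ->
  exists F : {set {set V}}, [/\ is_balanced_complete r 1 F, F \subset H & #|F| = 1].
Proof.
move=> rH /set0Pn[e eH].
have se : size (enum e) == r by rewrite -cardE rH.
pose t0 := Tuple se.
have [|t tP|F [Fb FH cF]] :=
  @complete_of_boxes V r 1 H (fun i => [set tnth t0 i]) rH isT.
- by move=> i; rewrite cards1.
- have -> : t = t0 by apply: eq_from_tnth => i; exact/set1P.
  by rewrite (_ : [set x in t0] = e) //; apply/setP => x; rewrite inE mem_enum.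
by exists F; rewrite cF exp1n.
Qed.

(** * Quantitative form of Erdős's theorem *)

(** The domination of the logarithm by the square root, for inverse density about $2^t$. *)
Lemma sqr_le_exp2 t : (t + 2) ^ 2 <= 8 * 2 ^ t.
Proof.
elim: t => [//|t IHt].
have [|t1] := leqP t 1; first by case: t {IHt} => [|[]].
rewrite (expnS 2 t); apply: leq_trans (_ : 2 * (t + 2) ^ 2 <= _); last by lia.
by rewrite !expnS expn0; nia.
Qed.

Lemma le_self_exp k m : 0 < k -> m <= m ^ k.
Proof.
by case: k => // k _; case: m => // m; rewrite expnS leq_pmulr // expn_gt0.
Qed.

(** Reduces the size condition of [exists_complete_boxes], with $q = 2^t$, to a bound on an exponent
    that can be compared with [trunc_log]. The factor [s] is absorbed through $s \le 2^s$. *)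
Lemma erdos_exponent k s t : 0 < k -> 0 < s ->
  (4 * 2 ^ t) ^ ((s + 2) ^ k) * s <= 2 ^ (2 * (t + 2) * (3 * s) ^ k).
Proof.
move=> k0 s0; rewrite -[4]/(2 ^ 2) -expnD -expnM.
apply: leq_trans (_ : _ <= 2 ^ ((2 + t) * (s + 2) ^ k) * 2 ^ s) _.
  by rewrite leq_mul2l (ltnW (ltn_expl _ _)) ?orbT.
rewrite -expnD leq_pexp2l //.
have : (s + 2) ^ k <= (3 * s) ^ k by rewrite leq_exp2r //; lia.
have : s <= (3 * s) ^ k by apply: leq_trans (le_self_exp _ k0); lia.
by nia.
Qed.

(* The maximal [s] in the Erdős bound may be [0]; a single edge then serves as
   [K_{1:r}], and the lower bound on [s] only loses a constant. *)
Lemma exists_large_complete (V : finType) k (H : {set {set V}}) :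
  0 < k -> 1 < #|V| -> is_rgraph k.+1 H -> H != set0 ->
  exists s t (F : {set {set V}}),
    [/\ [/\ 0 < s, is_balanced_complete k.+1 s F, F \subset H & #|F| = s ^ k.+1],
        s ^ k <= trunc_log 2 #|V|,
        2 ^ t * #|H| <= 2 * #|V| ^ k.+1
      & trunc_log 2 #|V| < (12 * (t + 2) * s) ^ k].
Proof.
move=> k0 V1 rH H0; have V0 : 0 < #|V| by exact: ltnW.
have cH0 : 0 < #|H| by rewrite card_gt0.
set N := #|V| ^ k.+1; set l := trunc_log 2 #|V|.
(* The least such [t] is the inverse density's logarithm rounded up; minimality costs only a factor
   2. *)
have ext : exists t, N <= 2 ^ t * #|H|.
  exists N; apply: leq_trans (ltnW (ltn_expl N (ltnSn 1))) _.
  by rewrite leq_pmulr.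
case: (ex_minnP ext) => t dens min_t.
have le_t : 2 ^ t * #|H| <= 2 * N.
  case: t dens min_t => [|t] _ min_t.
    by rewrite mul1n; have := card_rgraph_le rH; rewrite -/N; lia.
  have : ~~ (N <= 2 ^ t * #|H|) by apply/negP => /min_t; rewrite ltnn.
  by rewrite -ltnNge expnS -mulnA leq_mul2l => /ltnW ->.
have exs : exists s, 2 * (t + 2) * (3 * s) ^ k <= l.
  by exists 0; rewrite muln0 exp0n // muln0.
have bnds s : 2 * (t + 2) * (3 * s) ^ k <= l -> s <= l.
  apply: leq_trans; apply: leq_trans (_ : (3 * s) ^ k <= _).
    by apply: leq_trans (le_self_exp _ k0); lia.
  by rewrite leq_pmull // muln_gt0 addnS.
case: (ex_maxnP exs bnds) => s le_s max_s.
have lt_l : l < 2 * (t + 2) * (3 * s.+1) ^ k.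
  by rewrite ltnNge; apply/negP => /max_s; rewrite ltnn.
(* Used with [s'] equal to [s] if [s] is positive and to 1 otherwise; maximality of [s] bounds [l]
   through [s.+1]. *)
have le_base s' : s.+1 <= 2 * s' -> l < (12 * (t + 2) * s') ^ k.
  move=> le_s'; apply: leq_trans lt_l _.
  have -> : 12 * (t + 2) * s' = 2 * (t + 2) * (3 * (2 * s')) by nia.
  rewrite (expnMn (2 * (t + 2))) leq_mul ?le_self_exp // leq_exp2r //; lia.
have l1 : 0 < l by rewrite trunc_log_gt0.
case: (posnP s) => [s0|s0].
  have [F [Fb FH cF]] := complete_of_edge rH H0.
  by exists 1, t, F; rewrite !exp1n; split=> //; apply: le_base; rewrite s0.
have le_sV : (4 * 2 ^ t) ^ ((s + 2) ^ k) * s <= #|V|.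
  apply: leq_trans (erdos_exponent t k0 s0) _.
  by apply: leq_trans (trunc_logP (ltnSn 1) V0); rewrite leq_pexp2l.
have t0 : 0 < 2 ^ t by rewrite expn_gt0.
have [|P [cP PH]] := exists_complete_boxes V0 s0 t0 le_sV
    (E := [set u : k.+1.-tuple V | [set x in u] \in H]).
  by apply: leq_trans dens _; rewrite leq_mul2l card_le_edge_tuples ?orbT.
have [|F [Fb FH cF]] := complete_of_boxes rH s0 cP.
  by move=> u /PH; rewrite inE.
exists s, t, F; split=> //; last by apply: le_base; lia.
apply: leq_trans le_s; apply: leq_trans (_ : (3 * s) ^ k <= _).
  by rewrite leq_exp2r //; lia.
by rewrite leq_pmull // muln_gt0 addnS.
Qed.

Local Open Scope ring_scope.

(** * Passage to real logarithms and roots *)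

Lemma log2_trunc_log (R : realType) n : (0 < n)%N ->
  (trunc_log 2 n)%:R <= log2 (n%:R : R) < (trunc_log 2 n).+1%:R.
Proof.
move=> n0; have ln2 : 0 < ln 2 :> R by rewrite ln_gt0 // ltr1n.
have lnX m : ln ((2 ^ m)%:R : R) = m%:R * ln 2.
  by rewrite natrX lnXn ?ltr0n // mulr_natl.
have n0R : 0 < n%:R :> R by rewrite ltr0n.
rewrite /log2 ler_pdivlMr // ltr_pdivrMr // -!lnX.
have p0 m : 0 < (2 ^ m)%:R :> R by rewrite ltr0n expn_gt0.
by rewrite ler_ln ?posrE // ltr_ln ?posrE // ler_nat ltr_nat; exact: trunc_log_bounds.
Qed.

Lemma powR_invn_expn (R : realType) (x : R) k :
  (0 < k)%N -> 0 <= x -> (x ^+ k) `^ k%:R^-1 = x.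
Proof.
move=> k0 x0; rewrite -powR_mulrn // -powRrM mulfV ?powRr1 //.
by rewrite pnatr_eq0 -lt0n.
Qed.

Lemma le_log2_root (R : realType) k s n : (0 < k)%N -> (0 < n)%N ->
  (s ^ k <= trunc_log 2 n)%N -> s%:R <= log2 (n%:R : R) `^ k%:R^-1.
Proof.
move=> k0 n0 le_s; have /andP[le_l _] := log2_trunc_log R n0.
rewrite -[leLHS](@powR_invn_expn _ _ k) // ge0_ler_powR ?nnegrE ?invr_ge0 ?exprn_ge0 //.
  exact: le_trans le_l.
by apply: le_trans le_l; rewrite -natrX ler_nat.
Qed.

Lemma log2_root_le (R : realType) k s n : (0 < k)%N -> (0 < n)%N ->
  (trunc_log 2 n < s ^ k)%N -> log2 (n%:R : R) `^ k%:R^-1 <= s%:R.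
Proof.
move=> k0 n0 lt_s; have /andP[le_l lt_l] := log2_trunc_log R n0.
rewrite -[leRHS](@powR_invn_expn _ _ k) // ge0_ler_powR ?nnegrE ?invr_ge0 ?exprn_ge0 //.
  exact: le_trans le_l.
by rewrite (le_trans (ltW lt_l)) // -natrX ler_nat.
Qed.

(** * Greedy removal of copies *)

(* The square root of the number of remaining edges is the potential of the
   greedy removal. *)
Lemma exists_cheap_complete (R : realType) (V : finType) k (H : {set {set V}}) :
  let L := log2 (#|V|%:R : R) `^ k%:R^-1 in
  (0 < k)%N -> (1 < #|V|)%N -> is_rgraph k.+1 H -> H != set0 ->
  exists s (F : {set {set V}}),
    [/\ [/\ (0 < s)%N, is_balanced_complete k.+1 s F, F \subset H & F != set0],
        s%:R <= L
      & L * s%:R ^+ k <= 96 * Num.sqrt (#|V| ^ k.+1)%:R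
          * (Num.sqrt #|H|%:R - Num.sqrt #|H :\: F|%:R)].
Proof.
move=> L k0 V1 rH H0; have V0 : (0 < #|V|)%N by exact: ltnW.
have [s [t [F [[s0 Fb FH cF] le_s le_t lt_l]]]] := exists_large_complete k0 V1 rH H0.
exists s, F; split; [split=> // | exact: le_log2_root | ].
  by rewrite -card_gt0 cF expn_gt0 s0.
have le_L := log2_root_le R k0 V0 lt_l; rewrite -/L in le_L.
set N := (#|V| ^ k.+1)%N in le_t *.
have cH : #|H| = (#|H :\: F| + s ^ k.+1)%N.
  by rewrite -cF addnC -(cardsID F H) (setIidPr FH).
have e0 : 0 < Num.sqrt (#|H|%:R : R) by rewrite sqrtr_gt0 ltr0n card_gt0.
set e := #|H| in cH e0 le_t *; set e' := #|H :\: F| in cH *.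
(* Squared: $(t+2)^2 e \le 8 \cdot 2^t e \le 16N$. *)
have le_tN : (t + 2)%:R * Num.sqrt (e%:R : R) <= 4 * Num.sqrt N%:R.
  rewrite -(@ler_pXn2r _ 2) ?nnegrE ?mulr_ge0 ?sqrtr_ge0 //.
  rewrite !exprMn !sqr_sqrtr // -!natrX -!natrM ler_nat.
  apply: (@leq_trans (8 * 2 ^ t * e)%N); first by rewrite leq_mul2r sqr_le_exp2 orbT.
  by rewrite -mulnA; apply: (@leq_trans (8 * (2 * N))%N); [rewrite leq_mul2l le_t | lia].
have le_Le : L * Num.sqrt e%:R <= 48 * s%:R * Num.sqrt N%:R.
  apply: le_trans (_ : 12 * s%:R * ((t + 2)%:R * Num.sqrt e%:R) <= _).
    rewrite mulrA ler_wpM2r ?sqrtr_ge0 //; apply: le_trans le_L _.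
    by rewrite -!natrM ler_nat; nia.
  apply: le_trans (_ : 12 * s%:R * (4 * Num.sqrt N%:R) <= _).
    by rewrite ler_wpM2l // mulr_ge0.
  by rewrite le_eqVlt; apply/orP; left; apply/eqP; ring.
have sub_e : s%:R ^+ k.+1 = Num.sqrt (e%:R : R) ^+ 2 - Num.sqrt e'%:R ^+ 2.
  by rewrite !sqr_sqrtr // cH natrD natrX addrC addKr.
set a := Num.sqrt e%:R in e0 le_tN le_Le sub_e *.
set b := Num.sqrt e'%:R in sub_e *.
have le_ba : b <= a by rewrite ler_sqrt // ler_nat cH leq_addr.
have b0 : 0 <= b by exact: sqrtr_ge0.
set M := Num.sqrt N%:R in le_tN le_Le *.
have M0 : 0 <= M by exact: sqrtr_ge0.
(* After multiplication by [a], the left side is at most $48M(a^2-b^2) = 48M(a-b)(a+b)$, and $a+b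
   \le 2a$ doubles 48 to 96. *)
rewrite -(ler_pM2r e0) mulrAC.
apply: le_trans (_ : 48 * s%:R * M * s%:R ^+ k <= _).
  by rewrite ler_wpM2r // exprn_ge0.
have -> : 48 * s%:R * M * s%:R ^+ k = 48 * M * s%:R ^+ k.+1 by rewrite exprS; ring.
rewrite sub_e.
have -> : 96 * M * (a - b) * a = 48 * M * ((a - b) * (a + a)) by ring.
rewrite subr_sqr ler_wpM2l ?mulr_ge0 // ler_wpM2l ?subr_ge0 //.
by rewrite lerD2l.
Qed.

(** Induction on the number of edges, removing one cheap copy at a time; the cost bounds telescope
    in the square root of the edge count. *)
Lemma exists_cheap_decomposition (R : realType) (V : finType) k (H : {set {set V}}) :
  let L := log2 (#|V|%:R : R) `^ k%:R^-1 in
  (0 < k)%N -> (1 < #|V|)%N -> is_rgraph k.+1 H ->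
  exists (m : nat) (s : 'I_m -> nat) (F : 'I_m -> {set {set V}}),
    [/\ is_edge_decomposition H F,
        forall i, (0 < s i)%N /\ is_balanced_complete k.+1 (s i) (F i),
        forall i, (s i)%:R <= L
      & L * \sum_(i < m) (s i)%:R ^+ k
          <= 96 * Num.sqrt (#|V| ^ k.+1)%:R * Num.sqrt #|H|%:R].
Proof.
move=> L k0 V1; have [e] := ubnP #|H|; elim: e H => // e IHe H le_e rH.
have [->|H0] := eqVneq H set0.
  exists 0, (fun=> 1%N), (fun=> set0); split; try by case.
    by split; [case | rewrite big_ord0].
  by rewrite big_ord0 cards0 sqrtr0 !mulr0.
have [s [F [[s0 Fb FH F0] le_s cost]]] := exists_cheap_complete R k0 V1 rH H0.
have [||m [s' [F' [[disF' defH'] sF' le_s' cost']]]] := IHe (H :\: F).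
- have := cardsID F H; rewrite (setIidPr FH); have := F0; rewrite -card_gt0; lia.
- by move=> x /setDP[/rH].
(* Index 0 carries the removed copy; the other indices are those of the rest, shifted by one. *)
exists m.+1, (fun i => oapp s' s (unlift ord0 i)), (fun i => oapp F' F (unlift ord0 i)).
have disFF' i : [disjoint F & F' i].
  have F'i : F' i \subset H :\: F by rewrite defH' (bigcup_sup i).
  by rewrite disjoint_sym (disjointWl F'i) // disjoints_subset subsetDr.
split.
- split.
    move=> i j; case: (unliftP ord0 i) => [i'|] ->;
      case: (unliftP ord0 j) => [j'|] -> //=.
    + by rewrite (inj_eq lift_inj); exact: disF'.
    + by rewrite disjoint_sym.
  rewrite big_ord_recl unlift_none /=; under eq_bigr do rewrite liftK /=.
  by rewrite -defH' -[F in F :|: _](setIidPr FH) setID.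
- by move=> i; case: unliftP => [j|] _ /=.
- by move=> i; case: unliftP => [j|] _ /=.
rewrite big_ord_recl unlift_none /=; under eq_bigr do rewrite liftK /=.
rewrite mulrDr; apply: le_trans (lerD cost cost') _.
by rewrite -mulrDr subrK.
Qed.

Theorem theorem2p3 (R : realType) (r : nat) (hr : (2 <= r)%N) :
  exists c : R,
    forall (n : nat) (T : finType) (H : {set {set T}}),
      (r <= n)%N -> #|T| = n -> is_rgraph r H ->
      exists (m : nat) (s : 'I_m -> nat) (F : 'I_m -> {set {set T}}),
        [/\ is_edge_decomposition H F,
            forall i : 'I_m, (0 < s i)%N /\ is_balanced_complete r (s i) (F i),
            forall i : 'I_m,
              (s i)%:R <= log2 (n%:R : R) `^ (r - 1)%:R^-1
          & \sum_(i < m) ((s i)%:R : R) ^+ (r - 1)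
              <= c * n%:R ^+ r / (log2 (n%:R : R) `^ (r - 1)%:R^-1)].
Proof.
exists 96 => n T H le_rn cT; case: r hr le_rn => // k k1 le_kn; rewrite subn1 /= => rH.
have T1 : (1 < #|T|)%N by rewrite cT; exact: leq_trans le_kn.
have [m [s [F [decF sF le_s cost]]]] := exists_cheap_decomposition R k1 T1 rH.
rewrite cT in T1 le_s cost; exists m, s, F; split=> //.
have L0 : 0 < log2 (n%:R : R) `^ k%:R^-1.
  rewrite powR_gt0 //; have /andP[le_l _] := log2_trunc_log R (ltnW T1).
  by apply: lt_le_trans le_l; rewrite ltr0n trunc_log_gt0.
rewrite ler_pdivlMr // mulrC; apply: le_trans cost _.
(* Since $|H| \le n^r$, the product of the two square roots is at most $n^r$. *)
rewrite -mulrA ler_wpM2l // -natrX -[leRHS]sqr_sqrtr // expr2 ler_wpM2l ?sqrtr_ge0 //.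
by rewrite ler_sqrt // ler_nat -cT card_rgraph_le.
Qed.
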